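(* Let $(\mathcal{G},X,T)$ be a decomposed graph of groups, $\Gamma=\pi_1(\mathcal{G},X)$, and let $x,y\in\Gamma$ be elements which commute. Then: (i) If $x$ is in an edge subgroup, then $y\in\mathcal{C}(x)$, i.e. $y$ is the label of a circuit at $x$. (ii) If $x$ is in a conjugate $gG_sg^{-1}$ of a vertex subgroup $G_s$ and $x$ is not in a conjugate of an edge subgroup, then $y$ is in the same conjugate $gG_sg^{-1}$. (iii) If neither $x$ nor $y$ is in a conjugate of a vertex subgroup, then $x=ghg^{-1}W^j$ and $y=gh'g^{-1}W^k$ for some $g,W\in\Gamma$, $j,k\in\mathbb{Z}$ and $h,h'$ in an edge subgroup $G_a^-$, such that $ghg^{-1}$, $gh'g^{-1}$ and $W$ commute pairwise. Moreover at least one of the following cases occurs: (i') $x$ or $y$ is in a conjugate of an edge subgroup; or the hypothesis (hence the conclusion) of (ii) holds; or the hypothesis (hence the conclusion) of (iii) holds.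
   Context: A finite graph $X$ consists of finite sets $\mathcal{A}_X$ (edges) and $\mathcal{S}_X$ (vertices), a fixed-point-free involution $a\mapsto -a$ of $\mathcal{A}_X$, and maps $\mathrm{o},\mathrm{e}:\mathcal{A}_X\to\mathcal{S}_X$ (origin, end) with $\mathrm{e}(a)=\mathrm{o}(-a)$. An orientation is a subset $\mathcal{A}_X^+\subset\mathcal{A}_X$ containing exactly one of $a,-a$ for each $a$. A graph of groups $(\mathcal{G},X)$ is a finite connected oriented graph $X$ with vertex groups $G_s$ ($s\in\mathcal{S}_X$), edge groups $G_a$ ($a\in\mathcal{A}_X^+$), and monomorphisms $f_a:G_a\to G_{\mathrm{o}(a)}$, $f_{-a}:G_a\to G_{\mathrm{e}(a)}$ for $a\in\mathcal{A}_X^+$. A decomposed graph of groups $(\mathcal{G},X,T)$ is a graph of groups together with a maximal tree $T$ of $X$. Its fundamental group $\pi_1(\mathcal{G},X)$ is the quotient of the free product of all $G_s$ and the free group on $\{t_a: a\in\mathcal{A}_X\}$ by the relations $f_a(h)=t_af_{-a}(h)t_a^{-1}$ ($a\in\mathcal{A}_X^+$, $h\in G_a$), $t_{-a}=t_a^{-1}$ ($a\in\mathcal{A}_X$), $t_a=1$ ($a\in\mathcal{A}_T$). Each $G_s$ embeds naturally in $\pi_1(\mathcal{G},X)$ and is identified with its image (a vertex subgroup). For $a\in\mathcal{A}_X^+$, put $G_a^-=f_a(G_a)\subset G_{\mathrm{o}(a)}$, $G_a^+=f_{-a}(G_a)\subset G_{\mathrm{e}(a)}$ (as subgroups of $\pi_1(\mathcal{G},X)$),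 and $\varphi_a=f_{-a}\circ f_a^{-1}:G_a^-\to G_a^+$; also $G_{-a}^{\mp}=G_a^{\pm}$ and $\varphi_{-a}=\varphi_a^{-1}$. The subgroups $G_a^{\pm}$ are the edge subgroups. In $\pi_1(\mathcal{G},X)$, $h=t_a\varphi_a(h)t_a^{-1}$ for $h\in G_a^-$. Trajets. Let $u\in G_{s_o}$, $v\in G_{s_e}$. A trajet from $u$ to $v$ with origin $s_o$ and end $s_e$ consists of: a path $(a_1,\dots,a_n)$ in $X$, $n\ge 0$, from $s_0=s_o$ to $s_n=s_e$ (with $s_i=\mathrm{e}(a_i)=\mathrm{o}(a_{i+1})$ for $0<i<n$; if $n=0$ the path is the single vertex $s_o=s_e$); elements $c_i^-\in G_{a_i}^-$, $c_i^+\in G_{a_i}^+$ with $c_i^+=\varphi_{a_i}(c_i^-)$, $i=1,\dots,n$; and elements $h_i\in G_{s_i}$, $i=0,\dots,n$, such that, if $n=0$, $u=h_0vh_0^{-1}$, and if $n\ge1$, $u=h_0c_1^-h_0^{-1}$, $c_i^+=h_ic_{i+1}^-h_i^{-1}$ for $1\le i\le n-1$, and $c_n^+=h_nvh_n^{-1}$. Its label is $h_0t_{a_1}h_1t_{a_2}\cdots t_{a_n}h_n\in\pi_1(\mathcal{G},X)$. A circuit at $u\in G_s$ (with origin $s$) is a trajet from $u$ to $u$ with origin and end both equal to $s$. The set of labels of circuits at $u$ with origin $s$ does not depend on the choice of a vertex $s$ with $u\in G_s$; it is denoted $\mathcal{C}(u)$. *)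

(* Defs.v *)
From HB Require Import structures.
From mathcomp Require Import all_boot ssrint.
From mathcomp Require Import boolp classical_sets.

Set Implicit Arguments.
Unset Strict Implicit.
Unset Printing Implicit Defensive.

Local Open Scope classical_set_scope.
Local Open Scope group_scope.

(* [groupType] is the structure of groups, possibly infinite; [{set T}] is the
   type of subsets of a finite type and [set T] the type of subsets T -> Prop. *)

Record graph := Graph {
  edge : finType;
  vertex : finType;
  edge_rev : edge -> edge;
  org : edge -> vertex;
  tgt : edge -> vertex;
  edge_revK : involutive edge_rev;
  edge_rev_neq : forall a, edge_rev a != a;
  tgtE : forall a, tgt a = org (edge_rev a)
}.
Arguments edge_rev {g} a.
Arguments org {g} a.
Arguments tgt {g} a.

Section Graph.
Variable X : graph.

(* [gpath s p s'] : the edges of p form a path from s to s'; the empty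
   sequence is the path reduced to the vertex s = s'. *)
Fixpoint gpath (s : vertex X) (p : seq (edge X)) (s' : vertex X) : bool :=
  if p is a :: p' then (org a == s) && gpath (tgt a) p' s' else s == s'.

Definition connected_graph : Prop :=
  (exists s : vertex X, True) /\
  (forall s s' : vertex X, exists p, gpath s p s').

Definition is_orientation (P : {set edge X}) : Prop :=
  forall a, (a \in P) (+) (edge_rev a \in P).

Record subgraph := Subgraph {
  sub_vertex : {set vertex X};
  sub_edge : {set edge X};
  sub_rev : forall a, a \in sub_edge -> edge_rev a \in sub_edge;
  sub_org : forall a, a \in sub_edge -> org a \in sub_vertex
}.

Definition subgraph_le (S T : subgraph) : Prop :=
  sub_vertex S \subset sub_vertex T /\ sub_edge S \subset sub_edge T.

Definition connected_subgraph (T : subgraph) : Prop :=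
  (exists s, s \in sub_vertex T) /\
  (forall s s', s \in sub_vertex T -> s' \in sub_vertex T ->
     exists p, all [in sub_edge T] p /\ gpath s p s').

(* A cycle is a nonempty closed path without backtracking which visits
   distinct vertices (the subgraph it spans is a polygon with size p sides). *)
Definition graph_cycle (s : vertex X) (p : seq (edge X)) : Prop :=
  [/\ p <> [::], gpath s p s, uniq (map org p)
    & sorted (fun a b => b != edge_rev a) p].

Definition is_tree (T : subgraph) : Prop :=
  connected_subgraph T /\
  (forall s p, all [in sub_edge T] p -> ~ graph_cycle s p).

Definition is_maximal_tree (T : subgraph) : Prop :=
  is_tree T /\ (forall S, is_tree S -> subgraph_le T S -> subgraph_le S T).

End Graph.

Record graph_of_groups := GraphOfGroups {
  gog_graph :> graph;
  gog_connected : connected_graph gog_graph;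
  positive : {set edge gog_graph};
  positive_orientation : is_orientation positive;
  vgroup : vertex gog_graph -> groupType;
  egroup : {a : edge gog_graph | a \in positive} -> groupType;
  (* f_a : G_a -> G_o(a) and f_(-a) : G_a -> G_e(a), for a positive *)
  forg : forall a, {multiplicative egroup a -> vgroup (org (val a))};
  ftgt : forall a, {multiplicative egroup a -> vgroup (tgt (val a))};
  forg_inj : forall a, injective (forg a);
  ftgt_inj : forall a, injective (ftgt a)
}.
Arguments positive : clear implicits.
Arguments vgroup : clear implicits.
Arguments egroup : clear implicits.
Arguments forg : clear implicits.
Arguments ftgt : clear implicits.

Record decomposed_graph_of_groups := DecomposedGraphOfGroups {
  dgog :> graph_of_groups;
  mtree : subgraph dgog;
  mtree_maximal : is_maximal_tree mtree
}.
Arguments mtree : clear implicits.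

(* The fundamental group, as words in the elements of the vertex groups and
   the letters t_a^{+1}, t_a^{-1}, modulo the congruence generated by the
   relations of the free product of the vertex groups and the free group on
   the t_a (first four constructors) and the defining relations. *)
Section FundamentalGroup.
Variable D : decomposed_graph_of_groups.

Definition letter : Type :=
  ({s : vertex D & vgroup D s} + edge D * bool)%type.

Definition vletter (s : vertex D) (g : vgroup D s) : letter :=
  inl (Tagged (fun s => vgroup D s : Type) g).
(* [tletter a true] stands for t_a and [tletter a false] for t_a^{-1} *)
Definition tletter (a : edge D) (b : bool) : letter := inr (a, b).

Definition word : Type := seq letter.

Inductive pi1_relator : word -> word -> Prop :=
| RelVertexMul s (g h : vgroup D s) :
    pi1_relator [:: vletter g; vletter h] [:: vletter (g * h)]
| RelVertexOne s : pi1_relator [:: vletter (1 : vgroup D s)] [::]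
| RelFreeR a : pi1_relator [:: tletter a true; tletter a false] [::]
| RelFreeL a : pi1_relator [:: tletter a false; tletter a true] [::]
| RelEdge a (h : egroup D a) :
    pi1_relator [:: vletter (forg D a h)]
      [:: tletter (val a) true; vletter (ftgt D a h); tletter (val a) false]
| RelRev a : pi1_relator [:: tletter (edge_rev a) true] [:: tletter a false]
| RelTree a : a \in sub_edge (mtree D) -> pi1_relator [:: tletter a true] [::].

Inductive word_cong : word -> word -> Prop :=
| CongRel u w w' v : pi1_relator w w' ->
    word_cong (u ++ w ++ v) (u ++ w' ++ v)
| CongRefl w : word_cong w w
| CongSym w w' : word_cong w w' -> word_cong w' w
| CongTrans w w' w'' : word_cong w w' -> word_cong w' w'' -> word_cong w w''.

Definition word_congb (w w' : word) : bool := `[< word_cong w w' >].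

Lemma word_congb_refl : reflexive word_congb.
Proof. by move=> w; apply/asboolP; exact: CongRefl. Qed.

Lemma word_congb_sym : symmetric word_congb.
Proof. by move=> w w'; apply/asboolP/asboolP; exact: CongSym. Qed.

Lemma word_congb_trans : transitive word_congb.
Proof.
move=> w' w w'' /asboolP ww' /asboolP w'w''; apply/asboolP.
exact: CongTrans ww' w'w''.
Qed.

Canonical word_congb_equiv :=
  EquivRel word_congb word_congb_refl word_congb_sym word_congb_trans.

Definition pi1 : Type := {eq_quot word_congb}%qT.
HB.instance Definition _ := Choice.on pi1.

Definition wclass (w : word) : pi1 := \pi_({eq_quot word_congb})%qT w.
Definition wrepr (x : pi1) : word := repr (x : {eq_quot word_congb}%qT).

Lemma wreprK : cancel wrepr wclass.
Proof. exact: reprK. Qed.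

Lemma wclassP w w' : wclass w = wclass w' <-> word_cong w w'.
Proof.
split=> [/(eqmodP word_congb_equiv) /asboolP //|ww'].
by apply/(eqmodP word_congb_equiv)/asboolP.
Qed.

Lemma wrepr_cong w : word_cong (wrepr (wclass w)) w.
Proof. by apply/wclassP; rewrite wreprK. Qed.

Lemma word_cong_ctx u v w w' :
  word_cong w w' -> word_cong (u ++ w ++ v) (u ++ w' ++ v).
Proof.
elim=> [u' z z' v' zz'|z|z z' _ /CongSym //|z z' z'' _ IH1 _ IH2].
- have := CongRel (u ++ u') (v' ++ v) zz'.
  by rewrite -!catA.
- exact: CongRefl.
- exact: CongTrans IH1 IH2.
Qed.

Lemma word_cong_cat u u' v v' :
  word_cong u u' -> word_cong v v' -> word_cong (u ++ v) (u' ++ v').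
Proof.
move=> uu' vv'; apply: CongTrans (word_cong_ctx [::] v uu') _ => /=.
by have := word_cong_ctx u' [::] vv'; rewrite !cats0.
Qed.

Definition letter_inv (l : letter) : letter :=
  match l with
  | inl g => vletter (tagged g)^-1
  | inr (a, b) => tletter a (~~ b)
  end.

Definition word_inv (w : word) : word := rev (map letter_inv w).

Lemma letter_invK : involutive letter_inv.
Proof.
case=> [[s g]|[a b]] /=; last by rewrite /tletter negbK.
by rewrite /vletter /= invgK.
Qed.

Lemma word_invK : involutive word_inv.
Proof.
move=> w; rewrite /word_inv map_rev revK -map_comp.
by rewrite -[RHS]map_id; apply: eq_map => l /=; exact: letter_invK.
Qed.

Lemma letter_inv_cong l : word_cong [:: l; letter_inv l] [::].
Proof.
case: l => [[s g]|[a b]] /=.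
- apply: CongTrans (CongRel [::] [::] (RelVertexMul g g^-1)) _.
  rewrite /= mulgV.
  exact: (CongRel [::] [::] (RelVertexOne s)).
- case: b => /=; first exact: (CongRel [::] [::] (RelFreeR a)).
  exact: (CongRel [::] [::] (RelFreeL a)).
Qed.

Lemma word_inv_congr w : word_cong (w ++ word_inv w) [::].
Proof.
elim: w => [|l w IH]; first exact: CongRefl.
rewrite /word_inv /= rev_cons -cats1 -/(word_inv w).
apply: CongTrans (letter_inv_cong l).
have := word_cong_ctx [:: l] [:: letter_inv l] IH.
by rewrite /= catA.
Qed.

Lemma word_inv_congl w : word_cong (word_inv w ++ w) [::].
Proof. by rewrite -{2}(word_invK w); exact: word_inv_congr. Qed.

Lemma word_cong_inv w w' : word_cong w w' -> word_cong (word_inv w) (word_inv w').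
Proof.
move=> ww'.
have h1 : word_cong (word_inv w) (word_inv w ++ (w' ++ word_inv w')).
  rewrite -{1}(cats0 (word_inv w)); apply: word_cong_cat; first exact: CongRefl.
  exact: CongSym (word_inv_congr w').
apply: CongTrans h1 _.
have h2 : word_cong (word_inv w ++ w') [::].
  apply: CongTrans (word_inv_congl w).
  by apply: word_cong_cat; [exact: CongRefl | exact: CongSym].
by rewrite catA; have := word_cong_cat h2 (CongRefl (word_inv w')).
Qed.

Definition pi1_one : pi1 := wclass [::].
Definition pi1_mul (x y : pi1) : pi1 := wclass (wrepr x ++ wrepr y).
Definition pi1_inv (x : pi1) : pi1 := wclass (word_inv (wrepr x)).

Lemma pi1_mulE w w' : pi1_mul (wclass w) (wclass w') = wclass (w ++ w').
Proof. by apply/wclassP/word_cong_cat; exact: wrepr_cong. Qed.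

Lemma pi1_invE w : pi1_inv (wclass w) = wclass (word_inv w).
Proof. by apply/wclassP/word_cong_inv; exact: wrepr_cong. Qed.

Lemma pi1_mulA : associative pi1_mul.
Proof.
move=> x y z; rewrite -(wreprK x) -(wreprK y) -(wreprK z).
by rewrite !pi1_mulE catA.
Qed.

Lemma pi1_mul1 : left_id pi1_one pi1_mul.
Proof. by move=> x; rewrite -(wreprK x) pi1_mulE. Qed.

Lemma pi1_mul1r : right_id pi1_one pi1_mul.
Proof. by move=> x; rewrite -(wreprK x) pi1_mulE cats0. Qed.

Lemma pi1_mulV : left_inverse pi1_one pi1_inv pi1_mul.
Proof.
move=> x; rewrite -(wreprK x) pi1_invE pi1_mulE.
by apply/wclassP; exact: word_inv_congl.
Qed.

Lemma pi1_mulVr : right_inverse pi1_one pi1_inv pi1_mul.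
Proof.
move=> x; rewrite -(wreprK x) pi1_invE pi1_mulE.
by apply/wclassP; exact: word_inv_congr.
Qed.

HB.instance Definition _ :=
  isGroup.Build pi1 pi1_mulA pi1_mul1 pi1_mul1r pi1_mulV pi1_mulVr.

Definition viota (s : vertex D) (g : vgroup D s) : pi1 := wclass [:: vletter g].
Definition stable_letter (a : edge D) : pi1 := wclass [:: tletter a true].

Lemma viotaM s : {morph @viota s : g h / g * h}.
Proof.
move=> g h; rewrite [RHS]pi1_mulE; apply/wclassP/CongSym.
exact: (CongRel [::] [::] (RelVertexMul g h)).
Qed.

HB.instance Definition _ s :=
  isMultiplicative.Build (vgroup D s) pi1 (@viota s) (@viotaM s).

Definition vertex_subgroup (s : vertex D) : set pi1 := range (@viota s).

(* [edge_minus a] is the subgroup G_a^-; for -a with a positive, this is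
   G_(-a)^- = G_a^+ = f_(-a)(G_a). *)
Inductive edge_minus : edge D -> set pi1 :=
| EdgeMinusPos a (h : egroup D a) : edge_minus (val a) (viota (forg D a h))
| EdgeMinusNeg a (h : egroup D a) :
    edge_minus (edge_rev (val a)) (viota (ftgt D a h)).

Definition edge_plus (a : edge D) : set pi1 := edge_minus (edge_rev a).

(* [phi_graph a c c'] : c is in G_a^- and phi_a(c) = c'. *)
Inductive phi_graph : edge D -> pi1 -> pi1 -> Prop :=
| PhiPos a (h : egroup D a) :
    phi_graph (val a) (viota (forg D a h)) (viota (ftgt D a h))
| PhiNeg a (h : egroup D a) :
    phi_graph (edge_rev (val a)) (viota (ftgt D a h)) (viota (forg D a h)).

Definition edge_subgroup (H : set pi1) : Prop :=
  exists a, H = edge_minus a \/ H = edge_plus a.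

(* The conjugate g H g^{-1}; MathComp's [x ^ g] is g^{-1} x g. *)
Definition conj_set (g : pi1) (H : set pi1) : set pi1 :=
  [set g * z * g^-1 | z in H].

Definition in_edge_subgroup (x : pi1) : Prop :=
  exists2 H, edge_subgroup H & H x.

Definition in_conj_edge_subgroup (x : pi1) : Prop :=
  exists g, exists2 H, edge_subgroup H & conj_set g H x.

Definition in_conj_vertex_subgroup (x : pi1) : Prop :=
  exists g s, conj_set g (vertex_subgroup s) x.

(* A trajet from u to v with origin so and end se. The sequences s_i, h_i,
   c_i^-, c_i^+ are indexed as usual, and only their values for i <= n (and
   0 < i for c) matter; [tr_edge i] is the edge a_(i+1). *)
Record trajet (u v : pi1) (so se : vertex D) := Trajet {
  tr_len : nat;
  tr_vertex : nat -> vertex D;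
  tr_edge : 'I_tr_len -> edge D;
  tr_cminus : nat -> pi1;
  tr_cplus : nat -> pi1;
  tr_h : nat -> pi1;
  tr_u_in : vertex_subgroup so u;
  tr_v_in : vertex_subgroup se v;
  tr_start : tr_vertex 0 = so;
  tr_end : tr_vertex tr_len = se;
  tr_org : forall i : 'I_tr_len, org (tr_edge i) = tr_vertex i;
  tr_tgt : forall i : 'I_tr_len, tgt (tr_edge i) = tr_vertex i.+1;
  tr_cminus_in : forall i : 'I_tr_len,
    edge_minus (tr_edge i) (tr_cminus i.+1);
  tr_cplus_in : forall i : 'I_tr_len,
    edge_plus (tr_edge i) (tr_cplus i.+1);
  tr_phi : forall i : 'I_tr_len,
    phi_graph (tr_edge i) (tr_cminus i.+1) (tr_cplus i.+1);
  tr_h_in : forall i, (i <= tr_len)%N -> vertex_subgroup (tr_vertex i) (tr_h i);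
  tr_eq0 : tr_len = 0%N -> u = tr_h 0 * v * (tr_h 0)^-1;
  tr_eq_first : (0 < tr_len)%N -> u = tr_h 0 * tr_cminus 1 * (tr_h 0)^-1;
  tr_eq_mid : forall i, (0 < i < tr_len)%N ->
    tr_cplus i = tr_h i * tr_cminus i.+1 * (tr_h i)^-1;
  tr_eq_last : (0 < tr_len)%N ->
    tr_cplus tr_len = tr_h tr_len * v * (tr_h tr_len)^-1
}.

Definition label u v so se (t : trajet u v so se) : pi1 :=
  tr_h t 0 * \prod_(i < tr_len t) (stable_letter (tr_edge i) * tr_h t i.+1).

(* C(u), the labels of the circuits at u. The origin s ranges over the
   vertices with u in G_s (this is part of [trajet u u s s]). *)
Definition circuit_labels (u : pi1) : set pi1 :=
  [set y | exists s (t : trajet u u s s), y = label t].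

End FundamentalGroup.

Definition expgz (G : groupType) (x : G) (n : int) : G :=
  match n with
  | Posz m => x ^+ m
  | Negz m => x ^- m.+1
  end.

(* Main.v *)
Require Import Defs.
From mathcomp Require Import all_boot ssralg ssrint intdiv zify.
From mathcomp Require Import boolp classical_sets.

(** The proof lets the fundamental group act on its universal covering
    (Bass-Serre) tree, whose vertices are the cosets of the vertex groups, with
    these groups and the groups of the edges as stabilizers.

    The tree is built concretely.  Fix a vertex [s0] of the graph and a set of
    representatives of the cosets of the edge group of [a] in the vertex group
    at the origin of [a].  A vertex of the tree is a normal form based at [s0],
    that is, a sequence [(h_0, a_1) (h_1, a_2) ...] of representatives and
    edges along a path from [s0], without backtracking; it stands for the coset
    of [h_0 t_(a_1) h_1 t_(a_2) ...], and removing its last letter gives its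
    neighbour on the side of the root.  A vertex group acts on the normal forms
    based at its vertex by pushing its elements through the letters
    ([nf_mul]), an edge carries the normal forms based at its end to those based
    at its origin ([nf_edge]), and the edge relations hold for these maps
    ([nf_edge_mul]).  The maximal tree identifies the normal forms based at
    different vertices, because closed paths in it act trivially
    ([nf_path_tree_loop]); this turns the maps into an action [act] of the whole
    group.  Since [g] takes the coset of [w] to the coset of [act g w]
    ([nf_label_act]), the stabilizer of a vertex is a conjugate of a vertex
    group; that of an edge is a conjugate of an edge group ([edge_stab]).
    The representatives and the elements pushed through them are taken in the
    fundamental group, so that crossing an edge is conjugation by its stable
    letter and all letters have the same type.

    For (i) and (ii), let [x] lie in a vertex group, so that it fixes the base
    vertex.  It also fixes the image of that vertex by [y], hence the normal
    form of this image, letter by letter; followed by an element of the vertex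
    group, this is a circuit at [x] with label [y] ([commute_circuit]).  If moreover [x] fixes no edge, this normal form is
    empty and [y] is in the vertex group.

    For (iii), a shortest path from a vertex to its image by [x] extends to an
    [x]-periodic ray.  Its image by [y] is again [x]-periodic, so both stay at
    bounded distance and have a common subray: [y], like [x], shifts the ray by
    an integer.  A combination [W] of [x] and [y] shifts it by the gcd of both
    integers, so [x] and [y] multiplied by suitable powers of [W] fix a whole
    subray, in particular an edge ([commuting_axis]). *)

Set Implicit Arguments.
Unset Strict Implicit.
Unset Printing Implicit Defensive.

Local Open Scope group_scope.

(** * Paths and maximal trees in finite graphs *)

Section GraphPaths.
Variable X : graph.
Implicit Types (a b : edge X) (s : vertex X) (p q : seq (edge X)).

Lemma org_rev a : org (edge_rev a) = tgt a.
Proof. by rewrite tgtE. Qed.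

Lemma tgt_rev a : tgt (edge_rev a) = org a.
Proof. by rewrite tgtE edge_revK. Qed.

Definition path_rev p := rev (map edge_rev p).

Lemma path_rev_cons a p : path_rev (a :: p) = path_rev p ++ [:: edge_rev a].
Proof. by rewrite /path_rev /= rev_cons -cats1. Qed.

Lemma gpath_catP s p q s' :
  gpath s (p ++ q) s' <-> exists2 m, gpath s p m & gpath m q s'.
Proof.
elim: p s => [|a p IH] s /=.
  by split=> [|[m /eqP-> //]]; exists s.
split=> [/andP[-> /IH [m ? ?]]|[m /andP[-> ?] ?]]; first by exists m.
by apply/IH; exists m.
Qed.

Lemma gpath_cat s p m q s' : gpath s p m -> gpath m q s' -> gpath s (p ++ q) s'.
Proof. by move=> sp mq; apply/gpath_catP; exists m. Qed.

Lemma gpath_rev s p s' : gpath s p s' -> gpath s' (path_rev p) s.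
Proof.
elim: p s => [|a p IH] s /=; first by rewrite eq_sym.
case/andP=> /eqP <- /IH h; rewrite path_rev_cons; apply: gpath_cat h _.
by rewrite /= org_rev tgt_rev !eqxx.
Qed.

Lemma sub_path_rev (T : subgraph X) p :
  all [in sub_edge T] p -> all [in sub_edge T] (path_rev p).
Proof. by rewrite /path_rev all_rev all_map; apply: sub_all => a; exact: sub_rev. Qed.

Lemma not_sorted_backtrack p :
  ~~ sorted (fun a b => b != edge_rev a) p ->
  exists u a z, p = u ++ [:: a, edge_rev a & z].
Proof.
elim: p => [//|a [//|b p] IH] /=.
have [-> _|/= _ /IH [u [c [z ->]]]] := eqVneq b (edge_rev a).
  by exists [::], a, p.
by exists (a :: u), c, z.
Qed.

Lemma not_uniq_org p :
  ~~ uniq (map org p) ->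
  exists u a v b z, p = u ++ (a :: v) ++ b :: z /\ org a = org b.
Proof.
elim: p => [//|a p IH] /=; rewrite negb_and negbK.
case/orP=> [/mapP [b /splitPr [v z] ab]|/IH [u [c [v [d [z [-> cd]]]]]]].
  by exists [::], a, v, b, z.
by exists (a :: u), c, v, d, z.
Qed.

(** Otherwise the path would be a cycle.  By induction on the length, whatever is
    insensitive to backtracking is therefore trivial on the closed paths of a
    tree. *)
Lemma tree_closed_path (T : subgraph X) s p :
  is_tree T -> all [in sub_edge T] p -> gpath s p s -> p <> [::] ->
  (exists u a z, p = u ++ [:: a, edge_rev a & z]) \/
  (exists u v z m, [/\ p = u ++ v ++ z, (0 < size v)%N, (size v < size p)%N,
                       gpath m v m & gpath s u m /\ gpath m z s]).
Proof.
move=> [_ acyc] pT sp p0.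
have [|/not_sorted_backtrack ?] := boolP (sorted (fun a b => b != edge_rev a) p);
  last by left.
move=> srt; right.
have [uq|/not_uniq_org] := boolP (uniq (map org p)).
  by exfalso; apply: (acyc s p pT); split.
case=> u [a [v [b [z [pE ab]]]]]; move: sp; rewrite pE.
case/gpath_catP=> m um /gpath_catP [m' vm' zm'].
have mm' : m' = m.
  by move: vm' zm' => /= /andP[/eqP <- _] /andP[/eqP <- _].
rewrite mm' in vm' zm'.
exists u, (a :: v), (b :: z), m; rewrite !size_cat /=; split=> //.
by rewrite addnCA -[ltnLHS]addn0 ltn_add2l addnS.
Qed.

Section AddLeaf.
Variables (T : subgraph X) (a : edge X).
Hypotheses (Ttree : is_tree T) (aT : org a \in sub_vertex T)
  (aNT : tgt a \notin sub_vertex T).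

Let leaf_edges := edge_rev a |: (a |: sub_edge T).
Let leaf_vertices := tgt a |: sub_vertex T.

Lemma leaf_rev b : b \in leaf_edges -> edge_rev b \in leaf_edges.
Proof.
rewrite !inE => /or3P[/eqP->|/eqP->|/sub_rev->]; last by rewrite !orbT.
  by rewrite edge_revK eqxx !orbT.
by rewrite eqxx.
Qed.

Lemma leaf_org b : b \in leaf_edges -> org b \in leaf_vertices.
Proof.
rewrite !inE => /or3P[/eqP->|/eqP->|/sub_org->]; last by rewrite orbT.
  by rewrite org_rev eqxx.
by rewrite aT orbT.
Qed.

Definition add_leaf := Subgraph leaf_rev leaf_org.

Lemma add_leaf_org b : b \in leaf_edges -> org b = tgt a -> b = edge_rev a.
Proof.
rewrite !inE => /or3P[/eqP-> //|/eqP-> e|/sub_org bT e].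
  by move: aNT; rewrite -e aT.
by move: aNT; rewrite -e bT.
Qed.

Lemma add_leaf_tgt b : b \in leaf_edges -> tgt b = tgt a -> b = a.
Proof.
move=> /leaf_rev bS e; rewrite -[b]edge_revK -[RHS]edge_revK.
by congr edge_rev; apply: add_leaf_org => //; rewrite org_rev.
Qed.

Lemma gpath_last s p b s' : gpath s (rcons p b) s' -> tgt b = s'.
Proof. by rewrite -cats1 => /gpath_catP [m _ /= /andP[_ /eqP]]. Qed.

(** A cycle through the new vertex would have to enter it by [a] and leave it
    by the reverse of [a]. *)
Lemma add_leaf_tree : is_tree add_leaf.
Proof.
have [[[s0 s0T] conn] acyc] := Ttree.
split.
  split; first by exists s0; rewrite inE s0T orbT.
  have toa s : s \in leaf_vertices ->
      exists p, all [in leaf_edges] p /\ gpath s p (org a).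
    rewrite !inE => /orP [/eqP ->|sT].
      by exists [:: edge_rev a]; rewrite /= !inE eqxx org_rev tgt_rev !eqxx.
    have [p [pT sp]] := conn _ _ sT aT; exists p; split=> //.
    by apply: sub_all pT => b; rewrite !inE => ->; rewrite !orbT.
  move=> s s' /toa [p [pS sp]] /toa [q [qS sq]]; exists (p ++ path_rev q).
  rewrite all_cat pS (sub_path_rev (T := add_leaf) qS); split=> //.
  exact: gpath_cat sp (gpath_rev sq).
move=> s p pS [p0 sp uq srt].
have NaE : org a != tgt a by apply: contra aNT => /eqP <-.
have ap : a \notin p.
  apply/negP=> /splitPr pE; case: pE pS sp uq srt {p0} => u [|b v].
    rewrite cats1; case: u => [|c u] pS.
      by move=> /= /andP[/eqP oa /eqP ta]; rewrite oa ta eqxx in NaE.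
    move=> sp; have sE := gpath_last (p := c :: u) sp; move: sp pS => /=.
    rewrite -sE => /andP[/eqP oc sp] /andP[cS _].
    rewrite (add_leaf_org cS oc) {c oc cS} in sp *.
    case: u sp => [|d u] /=; first by move=> _ _; rewrite edge_revK eqxx.
    rewrite tgt_rev map_rcons mem_rcons inE => /andP[/eqP-> _].
    by rewrite eqxx /= andbF.
  rewrite all_cat => /andP[_ /= /and3P[_ bS _]] /gpath_catP[m _] /=.
  case/and3P=> _ /eqP /(add_leaf_org bS) -> _ _.
  by case: u => [|c u] /=; rewrite ?cat_path /= eqxx ?andbF.
apply: (acyc s p) => //; apply/allP=> b bp.
have := allP pS _ bp; rewrite !inE => /or3P [/eqP bE|/eqP bE|//]; last first.
  by rewrite -bE bp in ap.
move: bp; rewrite bE => /splitPr pE; case: pE pS sp uq srt ap p0 => u v.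
case: (lastP u) => [|u' c].
  move=> pS sp; case: (lastP v) sp pS => [|v' c] /=.
    by rewrite org_rev tgt_rev => /andP[/eqP ta /eqP oa]; rewrite oa ta eqxx in NaE.
  move=> sp pS; have := gpath_last (p := edge_rev a :: v') sp.
  case/andP: sp => /eqP <- _; rewrite org_rev => cE.
  have cS : c \in leaf_edges.
    by case/andP: pS => _; rewrite all_rcons => /andP[].
  by rewrite (add_leaf_tgt cS cE) inE mem_rcons inE eqxx orbT.
rewrite all_cat => /andP[]; rewrite all_rcons => /andP[cS _] _.
case/gpath_catP=> m /gpath_last cE /= /andP[/eqP mE _].
rewrite -mE org_rev in cE; rewrite (add_leaf_tgt cS cE) => _ _.
by rewrite mem_cat mem_rcons inE eqxx.
Qed.

End AddLeaf.

Lemma gpath_leaves (P : {set vertex X}) s p s' :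
  gpath s p s' -> s \in P -> s' \notin P ->
  exists2 a, org a \in P & tgt a \notin P.
Proof.
elim: p s => [|a p IH] s /=; first by move=> /eqP-> ->.
case/andP=> /eqP oa ap sP s'P; have [aP|aP] := boolP (tgt a \in P).
  exact: IH ap aP s'P.
by exists a; rewrite ?oa.
Qed.

(** Otherwise some edge leaves the tree, and adding it would yield a larger
    tree. *)
Lemma maximal_tree_spans (T : subgraph X) s :
  connected_graph X -> is_maximal_tree T -> s \in sub_vertex T.
Proof.
move=> [_ conn] [Ttree Tmax]; apply/negPn/negP=> sT.
have [[[s0 s0T] _] _] := Ttree; have [p sp] := conn s0 s.
have [a aT aNT] := gpath_leaves sp s0T sT.
have leS : subgraph_le T (add_leaf aT).
  by split; apply/fintype.subsetP=> x xT; rewrite !inE xT !orbT.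
have [/fintype.subsetP /(_ (tgt a)) aT' _] := Tmax _ (add_leaf_tree Ttree aT aNT) leS.
by rewrite aT' ?inE ?eqxx in aNT.
Qed.

Lemma maximal_tree_path (T : subgraph X) s s' :
  connected_graph X -> is_maximal_tree T ->
  exists p, all [in sub_edge T] p /\ gpath s p s'.
Proof.
by move=> Xc Tm; have [[[_ conn] _] _] := Tm; apply: conn; apply: maximal_tree_spans.
Qed.

End GraphPaths.

(** * Commuting automorphisms of a tree *)

Lemma commute_expgz (G : groupType) (x y : G) n : commute x y -> commute x (expgz y n).
Proof.
by move=> xy; case: n => n; [|apply: commuteV]; exact: commuteX.
Qed.

(** The vertices of a rooted tree are encoded by the sequences of labels on
    their branches. *)
Section RootedTree.
Variables (L : Type) (E : Type) (ty : L -> E) (rv : E -> E).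
Hypotheses (rv_neq : forall e, rv e <> e) (rvK : involutive rv).
Implicit Types (u v w : seq L) (r f : nat -> seq L) (e : E).

(** The type of the last letter orients and labels the edge between a vertex and
    its parent.  As no type is its own reverse, a map that preserves types cannot
    exchange the ends of an edge. *)
Definition adj_type e u v : Prop :=
  (exists l, ty l = e /\ v = rcons u l) \/ (exists l, ty l = rv e /\ u = rcons v l).

Definition adj u v := exists e, adj_type e u v.

Lemma adj_take u v m :
  adj u v -> (m < size u)%N -> take m u = take m v /\ (size u <= (size v).+1)%N.
Proof.
case=> e [[l [_ ->]]|[l [_ ->]]] mu; rewrite size_rcons.
  by rewrite -cats1 takel_cat ?(ltnW mu) // ltnW // ltnW.
by rewrite size_rcons ltnS in mu; rewrite -cats1 takel_cat.
Qed.

Lemma adj_type_no_inversion e u v : adj_type e u v -> ~ adj_type e v u.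
Proof.
move=> [[l [le ->]]|[l [le ->]]] [[k [ke]]|[k [ke]]].
- by move/(congr1 size); rewrite !size_rcons => /eqP; rewrite ltn_eqF // ltnW.
- by move=> /rcons_inj [kl]; apply: (@rv_neq e); rewrite -ke -kl.
- by move=> /rcons_inj [kl]; apply: (@rv_neq e); rewrite -le kl.
- by move/(congr1 size); rewrite !size_rcons => /eqP; rewrite ltn_eqF // ltnW.
Qed.

Definition walk n f := forall i, (i < n)%N -> adj (f i) (f i.+1).

(** Each step of a walk adds or removes one letter at the far end of the branch, so the
    part near the root that [n] steps cannot reach stays the same. *)
Lemma walk_take n f m :
  walk n f -> (m + n <= size (f 0))%N -> take m (f 0) = take m (f n).
Proof.
elim: n f => [//|n IH] f fw; rewrite addnS => mn.
have [-> s01] := adj_take (fw 0 isT) (leq_ltn_trans (leq_addr _ _) mn).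
rewrite (IH (fun i => f i.+1)) //; first by move=> i /(fw i.+1).
by rewrite -ltnS; exact: leq_trans mn s01.
Qed.

Definition increasing r N := forall i, (N <= i)%N -> exists l, r i.+1 = rcons (r i) l.

(** Once a path without backtracking moves away from the root it does so
    forever, and it cannot approach the root forever. *)
Lemma nonbacktracking_increasing r :
  (forall i, adj (r i) (r i.+1)) -> (forall i, r i <> r i.+2) ->
  exists N, increasing r N.
Proof.
move=> radj rnb; have [[i iup]|noup] := EM (exists i l, r i.+1 = rcons (r i) l).
  exists i => j /subnK <-; elim: (j - i)%N => [//|k [l kl]].
  have [e [[l' [_ ?]]|[l' [_ e']]]] := radj (k + i).+1; first by exists l'.
  by move: e'; rewrite kl => /rcons_inj [/rnb].
have down i : size (r i) = (size (r i.+1)).+1.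
  have [e [[l [_ ?]]|[l [_ ->]]]] := radj i; last by rewrite size_rcons.
  by case: noup; exists i, l.
have sz i : size (r 0) = (size (r i) + i)%N.
  by elim: i => [|i ->]; rewrite ?addn0 // down addSnnS.
by have := sz (size (r 0)).+1; rewrite addnS => /eqP; rewrite ltn_eqF // ltnS leq_addl.
Qed.

Lemma increasing_size r N i : increasing r N -> size (r (N + i)) = (size (r N) + i)%N.
Proof.
move=> rN; elim: i => [|i IH]; rewrite ?addn0 // !addnS.
by have [l ->] := rN (N + i)%N (leq_addr _ _); rewrite size_rcons IH.
Qed.

Lemma increasing_take r N i j :
  increasing r N -> (N <= i <= j)%N -> take (size (r i)) (r j) = r i.
Proof.
move=> rN /andP[Ni /subnK <-]; elim: (j - i)%N => [|k IH].
  exact: take_size.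
have [l ->] := rN (k + i)%N (leq_trans Ni (leq_addl _ _)).
rewrite -cats1 takel_cat // -(subnKC Ni) addnCA !increasing_size //.
by rewrite leq_add2l leq_addl.
Qed.

(** Two rays that stay at bounded distance along a sequence of indices have a
    common subray. *)
Lemma increasing_merge r r' N N' C :
  increasing r N -> increasing r' N' ->
  (forall k, exists2 K, (k <= K)%N &
     exists f, [/\ walk C f, f 0 = r K & f C = r' K]) ->
  exists m n, forall i, r' (m + i)%N = r (n + i)%N.
Proof.
move=> rN r'N close; exists (N' + size (r N))%N, (N + size (r' N'))%N => i.
set a := (N' + _ + i)%N; set b := (N + _ + i)%N.
have aE : a = (N' + (size (r N) + i))%N by rewrite addnA.
have bE : b = (N + (size (r' N') + i))%N by rewrite addnA.
(* K is so large that C steps away from [r K] the first [size (r b)] labels,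
   which determine [r b] and [r' a], are still unchanged *)
have [K bigK [f [fw f0 fC]]] := close (a + b + C)%N.
have bK : (b <= K)%N by apply: leq_trans bigK; rewrite addnAC leq_addl.
have aK : (a <= K)%N by apply: leq_trans bigK; rewrite -addnA leq_addr.
have sab : size (r' a) = size (r b).
  by rewrite aE bE !increasing_size // addnCA.
rewrite -(increasing_take (i := a) (j := K) r'N); last first.
  by rewrite aK aE leq_addr.
rewrite -(increasing_take (i := b) (j := K) rN); last by rewrite bK bE leq_addr.
rewrite sab -f0 -fC; apply/esym/walk_take => //; rewrite f0.
have NK : (N <= K)%N by apply: leq_trans bK; rewrite bE leq_addr.
rewrite -(subnKC NK) bE !increasing_size // -addnA leq_add2l leq_subRL //.
by apply: leq_trans bigK; rewrite bE; lia.
Qed.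

Variables (P : seq L -> Prop) (G : groupType) (act : G -> seq L -> seq L).
Hypotheses (P_rcons : forall w l, P (rcons w l) -> P w)
  (P_act : forall g w, P w -> P (act g w))
  (act1 : forall w, P w -> act 1 w = w)
  (actM : forall g h w, P w -> act (g * h) w = act g (act h w))
  (act_adj : forall g e u v, adj_type e u v -> adj_type e (act g u) (act g v)).

Lemma P_take k w : P w -> P (take k w).
Proof.
elim/last_ind: w => [//|w l IH] Pw; have [kw|wk] := leqP k (size w).
  by rewrite -cats1 takel_cat //; apply: IH; exact: P_rcons Pw.
by rewrite take_oversize // size_rcons.
Qed.

(** Go down from [u] to the root, then up to [v]. *)
Lemma walk_connect u v : P u -> P v ->
  exists n f, [/\ walk n f, f 0 = u, f n = v & forall i, P (f i)].
Proof.
move=> Pu Pv; exists (size u + size v)%N.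
exists (fun i => if (i <= size u)%N then take (size u - i) u else take (i - size u) v).
have take_step k w : (k < size w)%N -> exists l, take k.+1 w = rcons (take k w) l.
  by case: w => // x w kw; exists (nth x (x :: w) k); exact: take_nth.
split; last first.
- by move=> i; case: ifP => _; exact: P_take.
- case: leqP => uv; last by rewrite addKn take_size.
  have /size0nil -> : size v = 0 by lia.
  by rewrite addn0 subnn take0.
- by rewrite /= subn0 take_size.
- move=> i iuv; have [iu|ui|iu] := ltngtP i (size u).
  + have /take_step [l] : (size u - i.+1 < size u)%N by lia.
    rewrite -subSn // subSS => ->; exists (rv (ty l)); right; exists l.
    by rewrite rvK.
  + have /take_step [l] : (i - size u < size v)%N by lia.
    by rewrite -subSn ?(ltnW ui) // => ->; exists (ty l); left; exists l.
  + have /take_step [l] : (0 < size v)%N by lia.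
    rewrite iu subnn subSnn !take0 => ->.
    by exists (ty l); left; exists l.
Qed.

(** [r] is eventually moved by [g] along itself, by [k] steps. *)
Definition shifts r g (k : int) : Prop :=
  exists m n : nat, (n%:Z = m%:Z + k)%R /\ forall i, act g (r (m + i)%N) = r (n + i)%N.

Lemma shiftsM r g h k k' : (forall i, P (r i)) ->
  shifts r g k -> shifts r h k' -> shifts r (g * h) (k + k')%R.
Proof.
move=> Pr [m [n [nE gr]]] [m' [n' [n'E hr]]].
exists (m + m')%N, (n + n')%N; split=> [|i]; first by rewrite !PoszD nE n'E GRing.addrACA.
by rewrite actM // [(m + m')%N]addnC -addnA hr addnCA gr -addnA.
Qed.

Lemma shiftsV r g k : (forall i, P (r i)) -> shifts r g k -> shifts r g^-1 (- k)%R.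
Proof.
move=> Pr [m [n [nE gr]]]; exists n, m; rewrite nE GRing.addrK; split=> // i.
by rewrite -gr -actM // mulVg act1.
Qed.

Lemma shiftsX r g k j : (forall i, P (r i)) ->
  shifts r g k -> shifts r (expgz g j) (j * k)%R.
Proof.
move=> Pr gk; have expn n : shifts r (g ^+ n) (n%:Z * k)%R.
  elim: n => [|n IH]; last by rewrite expgS intS GRing.mulrDl GRing.mul1r; exact: shiftsM.
  by exists 0, 0; split=> [|i]; rewrite ?GRing.mul0r // act1.
case: j => n; first exact: expn.
by rewrite NegzE GRing.mulNr; exact: shiftsV.
Qed.

Lemma shifts0 r g : shifts r g 0%R ->
  exists m, forall i, (m <= i)%N -> act g (r i) = r i.
Proof.
case=> m [n [/eqP]]; rewrite GRing.addr0 eqz_nat => /eqP -> gr; exists m => i /subnKC <-.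
exact: gr.
Qed.

(** Translate by the powers of [x] a path of minimal length, over all vertices,
    from a vertex to its image: a backtrack would yield a shorter path for another
    vertex, or an inversion if the length is one. *)
Lemma periodic_ray x w0 : P w0 -> (forall w, P w -> act x w <> w) ->
  exists n r, [/\ (0 < n)%N, forall i, P (r i), forall i, adj (r i) (r i.+1),
    forall i, r i <> r i.+2 & forall i, r (n + i)%N = act x (r i)].
Proof.
move=> Pw0 nofix.
pose path_to n := `[< exists f, [/\ forall i, P (f i), walk n f & f n = act x (f 0)] >].
have ex_path : exists n, path_to n.
  have [n [f [fw f0 fn Pf]]] := walk_connect Pw0 (P_act x Pw0).
  by exists n; apply/asboolP; exists f; rewrite fn f0.
have [n /asboolP [f [Pf fw fn]] nmin] := ex_minnP ex_path.
have n0 : (0 < n)%N.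
  by case: n fn {fw nmin} => // /esym /nofix; case.
pose r i := act (x ^+ (i %/ n)) (f (i %% n)).
have rE q j : (j <= n)%N -> r (q * n + j)%N = act (x ^+ q) (f j).
  rewrite leq_eqVlt => /predU1P [->|jn]; last first.
    by rewrite /r divnMDl // modnMDl divn_small // modn_small // addn0.
  rewrite -mulSnr -[(_ * n)%N]addn0 /r divnMDl // modnMDl div0n mod0n addn0.
  by rewrite fn -actM // -expgSr.
have Pr i : P (r i) by exact: P_act.
have rx i : r (n + i)%N = act x (r i).
  by rewrite /r divnDl // divnn n0 modnDl expgS actM.
have radj i : adj (r i) (r i.+1).
  rewrite (divn_eq i n) -addnS !rE ?ltn_pmod // ?(ltnW (ltn_pmod _ _)) //.
  by have [e ee] := fw _ (ltn_pmod i n0); exists e; exact: act_adj.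
exists n, r; split=> // i rii.
have [n1|n1] := leqP n 1%N.
  have r1 k : r k.+1 = act x (r k) by rewrite -rx (eqP (_ : n == 1%N)) // eqn_leq n1.
  have [e ee] := radj i; apply: (adj_type_no_inversion ee).
  by have := act_adj x ee; rewrite -!r1 -rii.
have : path_to (n - 2)%N.
  apply/asboolP; exists (fun j => r (i.+2 + j)%N); split=> //.
    by move=> j _; rewrite addnS; exact: radj.
  by rewrite addn0 -rii -rx -addn2 addnAC -addnA subnK // addnC.
by move/nmin; rewrite leqNgt ltn_subrL n0.
Qed.

(** The ray of [periodic_ray] points to an end fixed by everything that commutes
    with [x], and the elements fixing this end shift the ray by integers. *)
Lemma commuting_axis x y w0 : P w0 -> commute x y -> (forall w, P w -> act x w <> w) ->
  exists W j k w l, [/\ commute W x, commute W y, P (rcons w l) &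
    forall g, g = x * (expgz W j)^-1 \/ g = y * (expgz W k)^-1 ->
      act g w = w /\ act g (rcons w l) = rcons w l].
Proof.
move=> Pw0 xy nofix; have [n [r [n0 Pr radj rnb rx]]] := periodic_ray Pw0 nofix.
have [N rN] := nonbacktracking_increasing radj rnb.
pose r' i := act y (r i).
have r'adj i : adj (r' i) (r' i.+1).
  by have [e ee] := radj i; exists e; exact: act_adj.
have r'nb i : r' i <> r' i.+2.
  move/(congr1 (act y^-1)); rewrite -!actM // mulVg !act1 //; exact: rnb.
have [N' r'N'] := nonbacktracking_increasing r'adj r'nb.
have [C [f [fw f0 fC _]]] := walk_connect (Pr 0) (P_act y (Pr 0)).
have rX k : r (k * n)%N = act (x ^+ k) (r 0).
  by elim: k => [|k IH]; rewrite ?act1 // mulSn rx IH -actM // -expgS.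
have [|m [m' shift_y]] := increasing_merge rN r'N' (C := C).
  move=> k; exists (k * n)%N; first by rewrite leq_pmulr.
  exists (fun i => act (x ^+ k) (f i)); rewrite f0 fC /r' rX; split=> //.
    by move=> i /fw [e ee]; exists e; exact: act_adj.
  by rewrite -!actM // (commuteX k (commute_sym xy)).
have sy : shifts r y (m'%:Z - m%:Z)%R.
  by exists m, m'; rewrite GRing.addrC GRing.subrK.
have sx : shifts r x n%:Z by exists 0, n; split=> [|i]; rewrite ?GRing.add0r ?rx.
set b := (m'%:Z - m%:Z)%R in sy; have [p [q bez]] := Bezoutz n b.
pose d := gcdz n b; pose W := expgz x p * expgz y q.
have sW : shifts r W d.
  by rewrite /d -bez; apply: shiftsM => //; exact: shiftsX.
have residue g k : shifts r g k -> (d %| k)%Z ->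
    exists m, forall i, (m <= i)%N -> act (g * (expgz W (k %/ d)%Z)^-1) (r i) = r i.
  move=> gk dk; apply: shifts0; rewrite -[0%R](GRing.subrr k) -{3}(divzK dk).
  by apply: shiftsM => //; apply: shiftsV => //; exact: shiftsX.
have [M xM] := residue _ _ sx (dvdz_gcdl _ _).
have [M' yM'] := residue _ _ sy (dvdz_gcdr _ _).
pose i := (N + (M + M'))%N; have [l rl] := rN i (leq_addr _ _).
exists W, (n %/ d)%Z, (b %/ d)%Z, (r i), l; rewrite -rl; split=> //.
- apply/commute_sym/commuteM; exact: commute_expgz.
- by apply/commute_sym/commuteM; apply: commute_expgz; rewrite // /commute xy.
- have Mi : (M <= i)%N by rewrite /i; lia.
  have M'i : (M' <= i)%N by rewrite /i; lia.
  by move=> g [->|->]; rewrite ?xM ?yM' // ?(leqW Mi) ?(leqW M'i).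
Qed.

End RootedTree.

(** * Vertex and edge subgroups of the fundamental group *)

Lemma multiplicative1 (G H : groupType) (f : G -> H) :
  {morph f : x y / x * y} -> f 1 = 1.
Proof. by move=> fM; apply: (mulgI (f 1)); rewrite -fM !mulg1. Qed.

Lemma multiplicativeV (G H : groupType) (f : G -> H) :
  {morph f : x y / x * y} -> {morph f : x / x^-1}.
Proof.
by move=> fM x; apply/esym/mulg1_eq; rewrite -fM mulgV multiplicative1.
Qed.

Section Subgroups.
Variable D : decomposed_graph_of_groups.
Implicit Types (a : edge D) (s : vertex D) (c g h x y : pi1 D).

Definition viota1 s := multiplicative1 (@viotaM D s).

Definition viotaV s := multiplicativeV (@viotaM D s).

Lemma vertex_subgroup1 s : vertex_subgroup s 1.
Proof. by exists 1; rewrite ?viota1. Qed.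

Lemma vertex_subgroupM s g h :
  vertex_subgroup s g -> vertex_subgroup s h -> vertex_subgroup s (g * h).
Proof. by move=> [g' _ <-] [h' _ <-]; exists (g' * h'); rewrite ?viotaM. Qed.

Lemma vertex_subgroupV s g : vertex_subgroup s g -> vertex_subgroup s g^-1.
Proof. by move=> [g' _ <-]; exists g'^-1; rewrite ?viotaV. Qed.

Lemma stable_letterV a : (stable_letter a)^-1 = wclass [:: tletter a false].
Proof. exact: pi1_invE. Qed.

Lemma stable_letter_rev a : stable_letter (edge_rev a) = (stable_letter a)^-1.
Proof.
rewrite stable_letterV; apply/wclassP.
exact: (CongRel [::] [::] (RelRev a)).
Qed.

Lemma stable_letter_tree a : a \in sub_edge (mtree D) -> stable_letter a = 1.
Proof. by move=> aT; apply/wclassP; exact: (CongRel [::] [::] (RelTree aT)). Qed.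

Lemma edge_relation b (h : egroup D b) :
  viota (ftgt D b h) = viota (forg D b h) ^ stable_letter (val b).
Proof.
rewrite (_ : viota (forg D b h) = stable_letter (val b) *
  viota (ftgt D b h) * (stable_letter (val b))^-1); last first.
  rewrite stable_letterV [X in _ = X * _]pi1_mulE [RHS]pi1_mulE; apply/wclassP.
  exact: (CongRel [::] [::] (RelEdge h)).
by rewrite conjgE !mulgA mulgVK mulVg mul1g.
Qed.

Lemma edge_signP a :
  exists b : {a | a \in positive D}, a = val b \/ a = edge_rev (val b).
Proof.
have := @positive_orientation D a; have [aP _|_ /= aP] := boolP (a \in positive D).
  by exists (exist (fun a => a \in positive D) a aP); left.
by exists (exist (fun a => a \in positive D) _ aP); right; rewrite /= edge_revK.
Qed.

Lemma edge_rev_val (b b' : {a | a \in positive D}) : val b <> edge_rev (val b').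
Proof.
by move=> e; have := positive_orientation (val b'); rewrite -e !(valP b) (valP b').
Qed.

Lemma edge_minus_val b c : edge_minus (val b) c -> exists h : egroup D b, c = viota (forg D b h).
Proof.
move=> cb; suff: forall a, edge_minus a c -> a = val b ->
  exists h : egroup D b, c = viota (forg D b h) by move/(_ _ cb (erefl _)).
move=> a [b' h /val_inj <-|b' h /esym/edge_rev_val //]; by exists h.
Qed.

Lemma edge_minus_rev_val b c :
  edge_minus (edge_rev (val b)) c -> exists h : egroup D b, c = viota (ftgt D b h).
Proof.
move=> cb; suff: forall a, edge_minus a c -> a = edge_rev (val b) ->
  exists h : egroup D b, c = viota (ftgt D b h) by move/(_ _ cb (erefl _)).
move=> a [b' h /edge_rev_val //|b' h /(inv_inj (@edge_revK D))/val_inj <-].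
by exists h.
Qed.

Lemma edge_minus1 a : edge_minus a 1.
Proof.
have [b [] ->] := edge_signP a.
  have := EdgeMinusPos (1 : egroup D b).
  by rewrite (multiplicative1 (@gmulfM _ _ (forg D b))) viota1.
have := EdgeMinusNeg (1 : egroup D b).
by rewrite (multiplicative1 (@gmulfM _ _ (ftgt D b))) viota1.
Qed.

Lemma edge_minusM a c g : edge_minus a c -> edge_minus a g -> edge_minus a (c * g).
Proof.
have [b [] ->] := edge_signP a.
  move=> /edge_minus_val [h ->] /edge_minus_val [k ->].
  by rewrite -viotaM -gmulfM; exact: EdgeMinusPos.
move=> /edge_minus_rev_val [h ->] /edge_minus_rev_val [k ->].
by rewrite -viotaM -gmulfM; exact: EdgeMinusNeg.
Qed.

Lemma edge_minusV a c : edge_minus a c -> edge_minus a c^-1.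
Proof.
have [b [] ->] := edge_signP a.
  move=> /edge_minus_val [h ->].
  rewrite -viotaV -(multiplicativeV (@gmulfM _ _ (forg D b))).
  exact: EdgeMinusPos.
move=> /edge_minus_rev_val [h ->].
rewrite -viotaV -(multiplicativeV (@gmulfM _ _ (ftgt D b))).
exact: EdgeMinusNeg.
Qed.

Lemma edge_minus_vertex a c : edge_minus a c -> vertex_subgroup (org a) c.
Proof.
case=> b h; first by exists (forg D b h).
by rewrite org_rev; exists (ftgt D b h).
Qed.

Lemma phi_graph_conj a c : edge_minus a c -> phi_graph a c (c ^ stable_letter a).
Proof.
case=> b h; first by rewrite -edge_relation; exact: PhiPos.
by rewrite {2}edge_relation stable_letter_rev conjgK; exact: PhiNeg.
Qed.

Lemma edge_minus_conj a c :
  edge_minus a c -> edge_minus (edge_rev a) (c ^ stable_letter a).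
Proof.
move/phi_graph_conj; case=> b h; first exact: EdgeMinusNeg.
by rewrite edge_revK; exact: EdgeMinusPos.
Qed.

End Subgroups.

(** * Normal forms and the groupoid acting on them *)

Section NormalForms.
Variable D : decomposed_graph_of_groups.
Implicit Types (a b : edge D) (s : vertex D) (c g h x y : pi1 D).
Local Notation t := (@stable_letter D).

(** The representative of [h] modulo the edge group of [a]; it is [1] on the edge
    group itself, so that [1] detects backtracking. *)
Definition coset_rep a h : pi1 D :=
  if `[< edge_minus a h >] then 1
  else xget 1 [set k | edge_minus a (h^-1 * k)].

Lemma coset_rep_in a h : edge_minus a (h^-1 * coset_rep a h).
Proof.
rewrite /coset_rep; case: asboolP => [/edge_minusV|_]; first by rewrite mulg1.
by case: xgetP => [k -> //|/(_ h)] /=; rewrite mulVg; case; exact: edge_minus1.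
Qed.

Lemma coset_repE a h : {c | edge_minus a c & coset_rep a h = h * c}.
Proof.
by exists (h^-1 * coset_rep a h); [exact: coset_rep_in | rewrite mulVKg].
Qed.

Lemma coset_repM a h c : edge_minus a c -> coset_rep a (h * c) = coset_rep a h.
Proof.
move=> ac; have acE k : edge_minus a (c * k) = edge_minus a k.
  apply/propext; split=> [ack|]; last exact: edge_minusM.
  by rewrite -[k](mulKg c); apply: edge_minusM => //; exact: edge_minusV.
have acV k : edge_minus a (c^-1 * k) = edge_minus a k.
  by rewrite -[in RHS](mulVKg c k) acE.
have hcE : edge_minus a (h * c) = edge_minus a h.
  apply/propext; split=> [ahc|ah]; last exact: edge_minusM.
  by rewrite -[h](mulgK c); apply: edge_minusM => //; exact: edge_minusV.
rewrite /coset_rep hcE; case: ifP => // _; congr xget.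
by apply/funext=> k /=; rewrite invgM -mulgA acV.
Qed.

Lemma coset_rep1P a h : coset_rep a h = 1 <-> edge_minus a h.
Proof.
split=> [e|ah]; last by rewrite /coset_rep asboolT.
by rewrite -[h]invgK -[h^-1]mulg1 -e; apply: edge_minusV; exact: coset_rep_in.
Qed.

Lemma coset_rep_idem a h : coset_rep a (coset_rep a h) = coset_rep a h.
Proof. by have [c ac {1}->] := coset_repE a h; rewrite coset_repM. Qed.

Definition nletter : Type := (pi1 D * edge D)%type.
Implicit Types (l : nletter) (w u v : seq nletter).

(** [nf s w s'] says that [w = (h_0, a_1) (h_1, a_2) ...] is the normal form of
    a vertex of the universal covering tree based at [s]: it stands for the
    coset of [h_0 t_(a_1) h_1 t_(a_2) ...] modulo the group of [s']. *)
Fixpoint nf s w s' : Prop :=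
  if w is (h, a) :: w' then
    [/\ org a = s, vertex_subgroup (org a) h, coset_rep a h = h,
        ohead w' != Some (1, edge_rev a) & nf (tgt a) w' s']
  else s = s'.

(** The left action of [g] in a vertex group: push [g] through the letters
    from the left, the part of it lying in the edge group being conjugated by
    the stable letter and handed on to the next letter. *)
Fixpoint nf_mul g w : seq nletter :=
  if w is (h, a) :: w' then
    let h' := coset_rep a (g * h) in
    (h', a) :: nf_mul ((h'^-1 * (g * h)) ^ t a) w'
  else [::].

(** The action of the stable letter of [a], with cancellation of a backtrack. *)
Definition nf_edge a w : seq nletter :=
  if ohead w == Some (1, edge_rev a) then behead w else (1, a) :: w.

Lemma coset_rep_carry a h : edge_minus a ((coset_rep a h)^-1 * h).
Proof.
by rewrite -[_ * h]invgK invgM invgK; apply: edge_minusV; exact: coset_rep_in.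
Qed.

Lemma nf_mul_cons_edge a c w :
  edge_minus a c -> nf_mul c ((1, a) :: w) = (1, a) :: nf_mul (c ^ t a) w.
Proof.
by move=> ac /=; rewrite mulg1; move/coset_rep1P: ac => ->; rewrite invg1 mul1g.
Qed.

Lemma nf_mulM g1 g2 w : nf_mul (g1 * g2) w = nf_mul g1 (nf_mul g2 w).
Proof.
elim: w g1 g2 => [//|[h a] w IH] g1 g2 /=.
have -> : coset_rep a (g1 * coset_rep a (g2 * h)) = coset_rep a (g1 * g2 * h).
  by have [c ac ->] := coset_repE a (g2 * h); rewrite !mulgA (coset_repM _ ac).
congr (_ :: _); rewrite -IH; congr nf_mul; rewrite -conjMg.
by rewrite !mulgA mulgK.
Qed.

Lemma nf_mul1 s w s' : nf s w s' -> nf_mul 1 w = w.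
Proof.
elim: w s => [//|[h a] w IH] s /= [_ _ e _ /IH wE].
by rewrite mul1g e mulVg conj1g wE.
Qed.

(** The condition that excludes backtracking survives the action, as a
    representative in the edge group is [1] before and after. *)
Lemma ohead_nf_mul b s w s' c :
  nf s w s' -> edge_minus b c ->
  (ohead (nf_mul c w) == Some (1, b)) = (ohead w == Some (1, b)).
Proof.
case: w => [//|[h a] w] /= [_ _ e _ _] bc; apply/eqP/eqP=> [] [hE aE].
  rewrite aE in e hE *; move/coset_rep1P: hE => bch; congr (Some (_, _)).
  rewrite -e; apply/coset_rep1P.
  by rewrite -[h](mulKg c); apply: edge_minusM => //; exact: edge_minusV.
by rewrite hE aE mulg1; move/coset_rep1P: bc => ->.
Qed.

Lemma nf_nf_mul s w s' g : vertex_subgroup s g -> nf s w s' -> nf s (nf_mul g w) s'.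
Proof.
elim: w s g => [//|[h a] w IH] s g sg /= [oa ah _ hd nw].
have ac := edge_minus_conj (coset_rep_carry a (g * h)).
split=> //; last 2 first.
- by rewrite (ohead_nf_mul nw).
- by apply: IH => //; rewrite -org_rev; exact: edge_minus_vertex.
- have [c ac' ->] := coset_repE a (g * h).
  apply: vertex_subgroupM; last exact: edge_minus_vertex.
  by apply: vertex_subgroupM => //; rewrite oa.
- exact: coset_rep_idem.
Qed.

Lemma nf_nf_edge a w s' : nf (tgt a) w s' -> nf (org a) (nf_edge a w) s'.
Proof.
move=> nw; rewrite /nf_edge; case: ifPn => [/eqP|hd].
  by case: w nw => [//|l w] nw [lE]; rewrite lE in nw; case: nw; rewrite tgt_rev.
by split=> //; [exact: vertex_subgroup1 | apply/coset_rep1P; exact: edge_minus1].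
Qed.

Lemma nf_edgeK a w s' : nf (org a) w s' -> nf_edge a (nf_edge (edge_rev a) w) = w.
Proof.
rewrite {2}/nf_edge edge_revK; case: ifPn => [/eqP|hd nw].
  case: w => [//|l w] [lE] nw; rewrite lE in nw *; case: nw => _ _ _ hd _.
  by rewrite /nf_edge /= (negPf hd).
by rewrite /nf_edge /= eqxx.
Qed.

Lemma nf_edgeKV a w s' : nf (tgt a) w s' -> nf_edge (edge_rev a) (nf_edge a w) = w.
Proof.
by move=> nw; rewrite -{2}[a]edge_revK; apply: (@nf_edgeK _ _ s'); rewrite org_rev.
Qed.

(** The relations attached to the edges of the graph of groups. *)
Lemma nf_edge_mul a c w s' :
  edge_minus a c -> nf (tgt a) w s' ->
  nf_edge a (nf_mul (c ^ t a) w) = nf_mul c (nf_edge a w).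
Proof.
move=> ac nw; have ac' := edge_minus_conj ac.
rewrite /nf_edge (ohead_nf_mul nw ac'); case: ifPn => [/eqP|_]; last first.
  by rewrite nf_mul_cons_edge.
case: w nw => [//|l w] nw [lE]; rewrite lE in nw *.
by rewrite (nf_mul_cons_edge _ ac') stable_letter_rev conjgK.
Qed.

(** Transport along a path, read from its end to its origin. *)
Definition nf_path p w : seq nletter := foldr nf_edge w p.

Lemma nf_nf_path s p m w s' : gpath s p m -> nf m w s' -> nf s (nf_path p w) s'.
Proof.
elim: p s => [|a p IH] s /=; first by move/eqP->.
by case/andP=> /eqP <- ap /(IH _ ap); exact: nf_nf_edge.
Qed.

Lemma nf_path_cat p q w : nf_path (p ++ q) w = nf_path p (nf_path q w).
Proof. exact: foldr_cat. Qed.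

Lemma nf_path_revK s p m w s' :
  gpath s p m -> nf s w s' -> nf_path p (nf_path (path_rev p) w) = w.
Proof.
elim: p s w => [//|a p IH] s w /= /andP[/eqP <- ap] nw.
rewrite path_rev_cons nf_path_cat /= (IH (tgt a)) //.
  exact: nf_edgeK nw.
by rewrite -org_rev; apply: nf_nf_edge; rewrite tgt_rev.
Qed.

Lemma path_revK : involutive (@path_rev D).
Proof.
move=> p; rewrite /path_rev map_rev revK -map_comp -[RHS]map_id.
by apply: eq_map => a /=; exact: edge_revK.
Qed.

Lemma nf_path_revKV s p m w s' :
  gpath s p m -> nf m w s' -> nf_path (path_rev p) (nf_path p w) = w.
Proof.
by move/gpath_rev=> sp nw; rewrite -{2}(path_revK p) (nf_path_revK sp nw).
Qed.

(** By [tree_closed_path], a closed path in the tree can be shortened without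
    changing the transport along it, until it is empty. *)
Lemma nf_path_tree_loop s p w s' :
  all [in sub_edge (mtree D)] p -> gpath s p s -> nf s w s' -> nf_path p w = w.
Proof.
have [n] := ubnP (size p); elim: n s p w => // n IH s p w.
have [->//|/eqP p0] := eqVneq p [::]; rewrite ltnS => pn pT sp nw.
have [Ttree _] := mtree_maximal D.
case: (tree_closed_path Ttree pT sp p0) => [[u [a [z pE]]]|[u [v [z [m]]]]].
  rewrite pE in pn pT sp *.
  case/gpath_catP: sp => m um /= /and3P[/eqP am _]; rewrite tgt_rev am => mz.
  have uz := gpath_cat um mz.
  rewrite nf_path_cat /= (nf_edgeK (s' := s')).
    rewrite -nf_path_cat; apply: IH uz nw.
      by apply: leq_trans pn; rewrite !size_cat /= !addnS ltnS leqnSn.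
    by move: pT; rewrite !all_cat /= => /and3P[-> _ /andP[]].
  by rewrite am; apply: nf_nf_path nw.
case=> pE v0 vp vm [um mz]; have uz := gpath_cat um mz.
move: pn pT; rewrite pE !all_cat !nf_path_cat => pn /and3P[uT vT zT].
rewrite [nf_path v _](IH m) //; first last.
- exact: nf_nf_path nw.
- by rewrite -pE in pn; apply: leq_trans vp pn.
rewrite -nf_path_cat; apply: IH uz nw; last by rewrite all_cat uT.
apply: leq_trans pn; rewrite !size_cat ltn_add2l -[ltnLHS]add0n ltn_add2r //.
Qed.

End NormalForms.

(** * The action of the fundamental group on normal forms *)

Section Action.
Variables (D : decomposed_graph_of_groups) (s0 : vertex D).
Implicit Types (a b : edge D) (s : vertex D) (c g h x y : pi1 D).
Implicit Types (w u v : seq (nletter D)).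
Local Notation t := (@stable_letter D).

Lemma tree_path_exists s :
  exists p, all [in sub_edge (mtree D)] p /\ gpath s0 p s.
Proof. exact: maximal_tree_path (gog_connected D) (mtree_maximal D). Qed.

Definition tree_path s : seq (edge D) := projT1 (cid (tree_path_exists s)).

Lemma tree_path_sub s : all [in sub_edge (mtree D)] (tree_path s).
Proof. by rewrite /tree_path; case: cid => p []. Qed.

Lemma gpath_tree_path s : gpath s0 (tree_path s) s.
Proof. by rewrite /tree_path; case: cid => p []. Qed.

(** Normal forms based at [s] and those based at [s0] are identified along the
    tree, which lets every letter of a word act on the latter. *)
Definition to_base s w := nf_path (tree_path s) w.
Definition from_base s w := nf_path (path_rev (tree_path s)) w.

Lemma nf_to_base s w s' : nf s w s' -> nf s0 (to_base s w) s'.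
Proof. exact/nf_nf_path/gpath_tree_path. Qed.

Lemma nf_from_base s w s' : nf s0 w s' -> nf s (from_base s w) s'.
Proof. exact/nf_nf_path/gpath_rev/gpath_tree_path. Qed.

Lemma to_baseK s w s' : nf s w s' -> from_base s (to_base s w) = w.
Proof. exact/nf_path_revKV/gpath_tree_path. Qed.

Lemma from_baseK s w s' : nf s0 w s' -> to_base s (from_base s w) = w.
Proof. exact/nf_path_revK/gpath_tree_path. Qed.

Lemma to_base_id w s' : nf s0 w s' -> to_base s0 w = w.
Proof. exact: nf_path_tree_loop (tree_path_sub _) (gpath_tree_path _). Qed.

Lemma to_base_tree a w s' : a \in sub_edge (mtree D) -> nf (tgt a) w s' ->
  to_base (org a) (nf_edge a w) = to_base (tgt a) w.
Proof.
move=> aT nw; have nbw := nf_to_base nw.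
have {1}<- : from_base (tgt a) (to_base (tgt a) w) = w by exact: to_baseK nw.
rewrite {1}/to_base -[nf_edge a _]/(nf_path [:: a] _) -nf_path_cat.
rewrite /from_base -nf_path_cat; apply: nf_path_tree_loop nbw.
  rewrite !all_cat !tree_path_sub /= aT /=.
  exact: sub_path_rev (tree_path_sub _).
apply: (gpath_cat (m := tgt a)); last exact/gpath_rev/gpath_tree_path.
by apply: gpath_cat (gpath_tree_path _) _; rewrite /= !eqxx.
Qed.

Definition letter_act (l : letter D) w : seq (nletter D) :=
  match l with
  | inl g => to_base (tag g) (nf_mul (viota (tagged g)) (from_base (tag g) w))
  | inr (a, true) => to_base (org a) (nf_edge a (from_base (tgt a) w))
  | inr (a, false) => to_base (tgt a) (nf_edge (edge_rev a) (from_base (org a) w))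
  end.

Definition word_act (z : word D) w := foldr letter_act w z.

Lemma word_act_cons l z w : word_act (l :: z) w = letter_act l (word_act z w).
Proof. by []. Qed.

Lemma nf_letter_act l w s' : nf s0 w s' -> nf s0 (letter_act l w) s'.
Proof.
move=> nw; case: l => [[s g]|[a []]] /=; apply: nf_to_base.
- by apply: nf_nf_mul; [exists g | exact: nf_from_base].
- by apply: nf_nf_edge; exact: nf_from_base.
- by rewrite -org_rev; apply: nf_nf_edge; rewrite tgt_rev; exact: nf_from_base.
Qed.

Lemma nf_word_act z w s' : nf s0 w s' -> nf s0 (word_act z w) s'.
Proof. by move=> nw; elim: z => //= l z; exact: nf_letter_act. Qed.

Lemma word_act_cat z1 z2 w : word_act (z1 ++ z2) w = word_act z1 (word_act z2 w).
Proof. exact: foldr_cat. Qed.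

Lemma vletter_act s (g : vgroup D s) u s' :
  nf s u s' -> letter_act (vletter g) (to_base s u) = to_base s (nf_mul (viota g) u).
Proof. by move=> nu /=; rewrite (to_baseK nu). Qed.

Lemma tletter_act a u s' :
  nf (tgt a) u s' ->
  letter_act (tletter a true) (to_base (tgt a) u) = to_base (org a) (nf_edge a u).
Proof. by move=> nu /=; rewrite (to_baseK nu). Qed.

Lemma tletterV_act a u s' :
  nf (org a) u s' ->
  letter_act (tletter a false) (to_base (org a) u) =
  to_base (tgt a) (nf_edge (edge_rev a) u).
Proof. by move=> nu /=; rewrite (to_baseK nu). Qed.

Lemma relator_act z z' w s' :
  pi1_relator z z' -> nf s0 w s' -> word_act z w = word_act z' w.
Proof.
case=> [s g h|s|a|a|a h|a|a aT] nw.
- rewrite -(from_baseK s nw); have nv := nf_from_base s nw.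
  rewrite !word_act_cons /(word_act [::] _) !(vletter_act _ nv).
  rewrite (vletter_act _ (s' := s')); last by apply: nf_nf_mul nv; exists h.
  by rewrite viotaM nf_mulM.
- rewrite -[RHS](from_baseK s nw); have nv := nf_from_base s nw.
  by rewrite /= viota1 (nf_mul1 nv).
- have nv := nf_from_base (org a) nw; rewrite -(from_baseK (org a) nw).
  rewrite !word_act_cons /(word_act [::] _) (tletterV_act nv).
  rewrite (tletter_act (s' := s')) ?(nf_edgeK nv) //.
  by rewrite -org_rev; apply: nf_nf_edge; rewrite tgt_rev.
- have nv := nf_from_base (tgt a) nw; rewrite -(from_baseK (tgt a) nw).
  rewrite !word_act_cons /(word_act [::] _) (tletter_act nv).
  by rewrite (tletterV_act (s' := s')) ?(nf_edgeKV nv) //; apply: nf_nf_edge.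
- set b := val a; have nv := nf_from_base (org b) nw.
  rewrite -(from_baseK (org b) nw).
  have nev : nf (tgt b) (nf_edge (edge_rev b) (from_base (org b) w)) s'.
    by rewrite -org_rev; apply: nf_nf_edge; rewrite tgt_rev.
  rewrite !word_act_cons /(word_act [::] _) (tletterV_act nv) (vletter_act _ nv).
  rewrite (vletter_act _ nev) (tletter_act (s' := s')); last first.
    by apply: nf_nf_mul nev; exists (ftgt D a h).
  by rewrite edge_relation (nf_edge_mul (EdgeMinusPos h) nev) (nf_edgeK nv).
- by rewrite /= org_rev tgt_rev.
- by rewrite /= (to_base_tree aT (nf_from_base _ nw)) (from_baseK _ nw).
Qed.

Lemma word_cong_act z z' w s' :
  word_cong z z' -> nf s0 w s' -> word_act z w = word_act z' w.
Proof.
move=> zz'; elim: zz' w => {z z'} [u z z' v zz'|//|z z' _ IH|z z' z'' _ IH1 _ IH2] w nw.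
- rewrite !word_act_cat; congr word_act.
  by apply: relator_act zz' _; apply: nf_word_act; exact: nw.
- by rewrite IH.
- by rewrite IH1 // IH2.
Qed.

Definition act g w := word_act (wrepr g) w.

Lemma nf_act g w s' : nf s0 w s' -> nf s0 (act g w) s'.
Proof. exact: nf_word_act. Qed.

Lemma act_wclass z w s' : nf s0 w s' -> act (wclass z) w = word_act z w.
Proof. exact/word_cong_act/wrepr_cong. Qed.

Lemma act1 w s' : nf s0 w s' -> act 1 w = w.
Proof. exact: act_wclass. Qed.

Lemma actM g h w s' : nf s0 w s' -> act (g * h) w = act g (act h w).
Proof.
by move=> nw; rewrite (act_wclass _ nw) word_act_cat.
Qed.

Lemma act_viota s (g : vgroup D s) u s' :
  nf s u s' -> act (viota g) (to_base s u) = to_base s (nf_mul (viota g) u).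
Proof.
by move=> nu; rewrite (act_wclass _ (nf_to_base nu)) /word_act /= (to_baseK nu).
Qed.

Lemma act_stable_letter a u s' :
  nf (tgt a) u s' -> act (t a) (to_base (tgt a) u) = to_base (org a) (nf_edge a u).
Proof.
by move=> nu; rewrite (act_wclass _ (nf_to_base nu)) /word_act /= (to_baseK nu).
Qed.

Lemma act_vertex_fix s g : vertex_subgroup s g ->
  act g (to_base s [::]) = to_base s [::].
Proof. by case=> g' _ <-; rewrite (act_viota _ (s' := s)). Qed.

Lemma act_base g w s' : vertex_subgroup s0 g -> nf s0 w s' -> act g w = nf_mul g w.
Proof.
case=> g' _ <- nw; rewrite -[in LHS](to_base_id nw) (act_viota _ nw).
by apply/(@to_base_id _ s')/nf_nf_mul => //; exists g'.
Qed.

(** The representative of the coset that [w] stands for. *)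
Definition nf_label w : pi1 D := foldr (fun l g => l.1 * t l.2 * g) 1 w.

Lemma nf_label_mul s g w s' :
  vertex_subgroup s g -> nf s w s' ->
  vertex_subgroup s' ((nf_label (nf_mul g w))^-1 * (g * nf_label w)).
Proof.
elim: w s g => [|[h a] w IH] s g sg /=.
  by move=> <-; rewrite invg1 mul1g mulg1.
case=> [_ _ _ _ nw]; set h' := coset_rep a (g * h).
have ac := edge_minus_conj (coset_rep_carry a (g * h)).
have := IH _ _ _ nw; rewrite -org_rev; move/(_ _ (edge_minus_vertex ac)).
by congr vertex_subgroup; rewrite -/h' !invgM conjgE !mulgA.
Qed.

Lemma nf_label_edge a w s' :
  nf (tgt a) w s' -> nf_label (nf_edge a w) = t a * nf_label w.
Proof.
rewrite /nf_edge; case: ifPn => [/eqP|_ _] /=; last by rewrite mul1g.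
case: w => [//|l w] [->] _ /=.
by rewrite mul1g stable_letter_rev mulVKg.
Qed.

Lemma nf_label_tree_path p s m w s' :
  all [in sub_edge (mtree D)] p -> gpath s p m -> nf m w s' ->
  nf_label (nf_path p w) = nf_label w.
Proof.
elim: p s => [//|a p IH] s /= /andP[aT pT] /andP[_ ap] nw.
rewrite (nf_label_edge (nf_nf_path ap nw)) (IH _ pT ap nw).
by rewrite (stable_letter_tree aT) mul1g.
Qed.

Lemma nf_label_to_base s w s' : nf s w s' -> nf_label (to_base s w) = nf_label w.
Proof. exact: nf_label_tree_path (tree_path_sub _) (gpath_tree_path s). Qed.

Lemma nf_label_from_base s w s' :
  nf s0 w s' -> nf_label (from_base s w) = nf_label w.
Proof.
exact: nf_label_tree_path (sub_path_rev (tree_path_sub _))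
  (gpath_rev (gpath_tree_path s)).
Qed.

Lemma nf_label_letter_act l w s' :
  nf s0 w s' ->
  vertex_subgroup s' ((nf_label (letter_act l w))^-1 * (wclass [:: l] * nf_label w)).
Proof.
move=> nw; case: l => [[s g]|[a []]] /=.
- have nv := nf_from_base s nw; have sg : vertex_subgroup s (viota g) by exists g.
  rewrite (nf_label_to_base (nf_nf_mul sg nv)) -(nf_label_from_base s nw).
  exact: nf_label_mul nv.
- have nv := nf_from_base (tgt a) nw.
  rewrite (nf_label_to_base (nf_nf_edge nv)) (nf_label_edge nv).
  by rewrite (nf_label_from_base _ nw) mulVg; exact: vertex_subgroup1.
- have := nf_from_base (org a) nw; rewrite -tgt_rev => nv; rewrite -org_rev.
  rewrite (nf_label_to_base (nf_nf_edge nv)) (nf_label_edge nv) tgt_rev.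
  rewrite (nf_label_from_base _ nw) stable_letter_rev stable_letterV mulVg.
  exact: vertex_subgroup1.
Qed.

(** The map from normal forms to cosets is equivariant: each of the
    maps composing the action multiplies the label on the left, up to an element
    of the last vertex group on the right. *)
Lemma nf_label_act g w s' :
  nf s0 w s' -> vertex_subgroup s' ((nf_label (act g w))^-1 * (g * nf_label w)).
Proof.
move=> nw; rewrite -{2}(wreprK g) /act; elim: (wrepr g) => [|l z IH].
  by rewrite mul1g mulVg; exact: vertex_subgroup1.
rewrite (_ : wclass (l :: z) = wclass [:: l] * wclass z); last first.
  by rewrite [RHS]pi1_mulE.
have := vertex_subgroupM (nf_label_letter_act l (nf_word_act z nw)) IH.
by congr vertex_subgroup; rewrite /= !mulgA mulgK.
Qed.

Lemma act_stab g w s' :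
  nf s0 w s' -> act g w = w -> vertex_subgroup s' (g ^ nf_label w).
Proof. by move=> nw gw; have := nf_label_act g nw; rewrite gw. Qed.

End Action.

(** * Automorphisms and stabilizers of edges *)

Section TreeAction.
Variable D : decomposed_graph_of_groups.
Implicit Types (a b e : edge D) (s : vertex D) (c g h x y : pi1 D).
Implicit Types (l : nletter D) (w u v : seq (nletter D)).
Local Notation t := (@stable_letter D).
Local Notation nf_adj := (adj_type (@snd (pi1 D) (edge D)) (@edge_rev D)).

Definition preserves_adj (f : seq (nletter D) -> seq (nletter D)) :=
  forall e u v, nf_adj e u v -> nf_adj e (f u) (f v).

(** Reversing the type of an edge exchanges parent and child, so it is enough to
    consider an edge directed away from the root. *)
Lemma preserves_adj_rcons f :
  (forall w l, nf_adj l.2 (f w) (f (rcons w l))) -> preserves_adj f.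
Proof.
move=> fP e u v [[l [<- ->]]|[l [le ->]]]; first exact: fP.
case: (fP v l) => [[k [kl ->]]|[k [kl ->]]]; [right|left]; exists k.
  by rewrite kl.
by rewrite kl le edge_revK.
Qed.

Lemma preserves_adj_nf_mul g : preserves_adj (nf_mul g).
Proof.
apply: preserves_adj_rcons => w [h a]; left.
elim: w g => [|[h' a'] w IH] g /=.
  by eexists (_, a); split; last reflexivity.
by have [l [la ->]] := IH (((coset_rep a' (g * h'))^-1 * (g * h')) ^ t a'); exists l.
Qed.

Lemma preserves_adj_nf_edge b : preserves_adj (nf_edge b).
Proof.
apply: preserves_adj_rcons => -[|l' w] l; rewrite /nf_edge /=.
  case: eqP => [[->]|_]; last by left; exists l.
  by right; exists (1, b); rewrite edge_revK.
by case: eqP => _; left; exists l.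
Qed.

Lemma preserves_adj_nf_path p : preserves_adj (nf_path p).
Proof. by elim: p => // a p IH e u v /IH; exact: preserves_adj_nf_edge. Qed.

Lemma preserves_adj_act s0 g : preserves_adj (act s0 g).
Proof.
rewrite /act; elim: (wrepr g) => // l z IH e u v /IH {IH}.
by case: l => [[s h]|[a []]] /= uv;
  apply: preserves_adj_nf_path;
  by [apply: preserves_adj_nf_mul; apply: preserves_adj_nf_path
     |apply: preserves_adj_nf_edge; apply: preserves_adj_nf_path].
Qed.

Lemma nf_rcons s w h a s' : nf s (rcons w (h, a)) s' ->
  [/\ nf s w (org a), vertex_subgroup (org a) h & s' = tgt a].
Proof.
elim: w s => [|[h' a'] w IH] s /=; first by case=> -> ah _ _ <-.
case=> oa ah rh hd /IH [nw ah' sE]; split=> //; split=> //.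
by case: w hd {IH nw}.
Qed.

(** Seen from the base vertex [org a], the edge group fixes the neighbour
    [(1, a)], on which an element [c] of the vertex group acts by
    [coset_rep a c]. *)
Lemma edge_stab a c : vertex_subgroup (org a) c -> vertex_subgroup (tgt a) (c ^ t a) ->
  edge_minus a c.
Proof.
move=> oc tc; have na : nf (org a) (nf_edge a [::]) (tgt a) by exact: nf_nf_edge.
have nt := @nf_to_base D (org a) (tgt a) [::] (tgt a) erefl.
have edgeE : act (org a) (t a) (to_base (org a) (tgt a) [::]) = [:: (1, a)].
  by rewrite (act_stable_letter _ (s' := tgt a)) // (to_base_id na).
have := actM c (t a) nt; rewrite edgeE (act_base oc na) /=.
rewrite conjgC (actM _ _ nt) act_vertex_fix // edgeE mulg1 => -[].
by move/esym/coset_rep1P.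
Qed.

Lemma conjg_cancel g x : g * x ^ g * g^-1 = x.
Proof. by rewrite conjgE !mulgA mulgV mul1g mulgK. Qed.

Lemma conj_setE g (H : set (pi1 D)) x : conj_set g H x <-> H (x ^ g).
Proof.
split=> [[z Hz <-]|Hx]; first by rewrite conjgE !mulgA mulVg mul1g mulgVK.
by exists (x ^ g); rewrite ?conjg_cancel.
Qed.

(** * Elements commuting with an element of a vertex group *)

(** If [x] fixes the base vertex and commutes with [y], it also fixes the image
    of that vertex by [y], hence the path joining them. *)
Lemma commute_fixes_path s x y :
  vertex_subgroup s x -> commute x y ->
  exists w, [/\ nf s w s, nf_mul x w = w & vertex_subgroup s ((nf_label w)^-1 * y)].
Proof.
move=> sx xy; have n0 : nf s [::] s by [].
have nw := nf_act y n0; exists (act s y [::]); split=> //.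
  by rewrite -(act_base sx nw) -(actM _ _ n0) xy (actM _ _ n0) (act_base sx n0).
by have := nf_label_act y n0; rewrite mulg1.
Qed.

Lemma nf_label_rcons w l : nf_label (rcons w l) = nf_label w * l.1 * t l.2.
Proof. by elim: w => [|k w IH] /=; rewrite ?mul1g ?mulg1 // IH !mulgA. Qed.

(** That [x] fixes the letters of [w] one after the other means that the part of
    [x] handed on past each letter is its conjugate by what precedes. *)
Lemma nf_mul_fix s w s' x l0 i :
  nf s w s' -> nf_mul x w = w -> (i < size w)%N ->
  edge_minus (nth l0 w i).2 (x ^ (nf_label (take i w) * (nth l0 w i).1)).
Proof.
elim: w s x i => [//|[h a] w IH] s x i /= [_ _ _ _ nw] [hE wE].
case: i => [_|i iw] /=.
  by rewrite mul1g conjgE -{1}hE; exact: coset_rep_carry.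
rewrite -mulgA conjgM; apply: IH nw _ iw; rewrite -{2}wE; congr nf_mul.
by rewrite hE conjgM.
Qed.

Lemma nf_nth s w s' l0 i :
  nf s w s' -> (i < size w)%N ->
  org (nth l0 w i).2 = nth s (s :: map (fun l => tgt l.2) w) i /\
  vertex_subgroup (org (nth l0 w i).2) (nth l0 w i).1.
Proof.
elim: w s i => [//|[h a] w IH] s [|i] /= [oa ah _ _ nw] // iw.
have [-> ?] := IH _ _ nw iw; split=> //.
by apply: set_nth_default => /=; rewrite size_map ltnW.
Qed.

Lemma nf_end s w s' : nf s w s' -> nth s (s :: map (fun l => tgt l.2) w) (size w) = s'.
Proof.
elim: w s => [//|[h a] w IH] s /= [_ _ _ _ /IH <-].
by apply: set_nth_default; rewrite /= size_map.
Qed.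

Lemma nf_label_prod w k :
  nf_label w * k = nth 1 (rcons (map fst w) k) 0 *
    \prod_(i < size w) (t (tnth (in_tuple w) i).2 * nth 1 (rcons (map fst w) k) i.+1).
Proof.
elim: w => [|l w IH] /=; first by rewrite big_ord0 mul1g mulg1.
rewrite big_ord_recl (tnth_nth l) /= -!mulgA IH; congr (_ * (_ * (_ * _))).
by apply: eq_bigr => i _; rewrite !(tnth_nth l).
Qed.

Lemma commute_circuit s x y :
  vertex_subgroup s x -> commute x y -> circuit_labels x y.
Proof.
move=> sx xy; have [w [nw xw]] := commute_fixes_path sx xy.
set k := _^-1 * y => sk; have yE : y = nf_label w * k by rewrite mulVKg.
pose hs := rcons (map fst w) k; pose vs := s :: map (fun l => tgt l.2) w.
pose ed (i : 'I_(size w)) := (tnth (in_tuple w) i).2.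
(* the elements [c_i^-] and [c_i^+] are [x] conjugated by the part of the label
   that precedes them, which excludes or includes [t_(a_i)] *)
pose cm i := x ^ (nf_label (take i.-1 w) * nth 1 hs i.-1).
pose cp i := x ^ nf_label (take i w).
have nthE l0 (i : 'I_(size w)) : nth l0 w i = tnth (in_tuple w) i.
  by rewrite (tnth_nth l0).
have hsE (i : 'I_(size w)) : nth 1 hs i = (tnth (in_tuple w) i).1.
  set l0 := tnth _ i; rewrite nth_rcons size_map ltn_ord.
  by rewrite (nth_map l0) ?nthE.
have vs_end : nth s vs (size w) = s by exact: nf_end nw.
have cm_in (i : 'I_(size w)) : edge_minus (ed i) (cm i.+1).
  have := nf_mul_fix (tnth (in_tuple w) i) nw xw (ltn_ord i).
  by rewrite nthE -hsE.
have cpE (i : 'I_(size w)) : cp i.+1 = cm i.+1 ^ t (ed i).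
  rewrite /cp /cm (take_nth (tnth (in_tuple w) i)) // nthE nf_label_rcons /=.
  by rewrite -hsE conjgM.
have phi_in i : phi_graph (ed i) (cm i.+1) (cp i.+1).
  by rewrite cpE; exact: phi_graph_conj.
have cp_in i : edge_plus (ed i) (cp i.+1) by rewrite cpE; exact: edge_minus_conj.
have org_ed (i : 'I_(size w)) : org (ed i) = nth s vs i.
  have [<- _] := nf_nth (tnth (in_tuple w) i) nw (ltn_ord i).
  by rewrite nthE.
have tgt_ed (i : 'I_(size w)) : tgt (ed i) = nth s vs i.+1.
  by rewrite /= (nth_map (tnth (in_tuple w) i)) // nthE.
have hs_in i : (i <= size w)%N -> vertex_subgroup (nth s vs i) (nth 1 hs i).
  rewrite leq_eqVlt => /predU1P [->|iw].
    by rewrite vs_end nth_rcons size_map ltnn eqxx.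
  rewrite -[i]/(val (Ordinal iw)) hsE.
  have [<- ] := nf_nth (tnth (in_tuple w) (Ordinal iw)) nw iw.
  by rewrite -[i]/(val (Ordinal iw)) nthE.
have eq0 : size w = 0%N -> x = nth 1 hs 0 * x * (nth 1 hs 0)^-1.
  move/size0nil => w0; rewrite /hs w0 /=.
  have -> : k = y by rewrite yE w0 mul1g.
  by rewrite -xy mulgK.
have eq_first : (0 < size w)%N -> x = nth 1 hs 0 * cm 1%N * (nth 1 hs 0)^-1.
  by move=> _; rewrite /cm take0 /= mul1g conjg_cancel.
have eq_mid i : (0 < i < size w)%N -> cp i = nth 1 hs i * cm i.+1 * (nth 1 hs i)^-1.
  by move=> _; rewrite /cm /cp /= conjgM conjg_cancel.
have eq_last : (0 < size w)%N ->
    cp (size w) = nth 1 hs (size w) * x * (nth 1 hs (size w))^-1.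
  move=> _; rewrite /cp take_size /hs nth_rcons size_map ltnn eqxx.
  have -> : nf_label w = y * k^-1 by rewrite yE mulgK.
  rewrite conjgM (conjgE x y) xy mulKg.
  by rewrite conjgE invgK mulgA.
exists s, (Trajet sx sx erefl vs_end org_ed tgt_ed cm_in cp_in phi_in hs_in eq0
  eq_first eq_mid eq_last).
by rewrite /label /= yE nf_label_prod.
Qed.

(** A letter of the normal form of [y] would put a conjugate of [x] in the group
    of its edge. *)
Lemma commute_in_vertex s x y :
  vertex_subgroup s x -> ~ in_conj_edge_subgroup x -> commute x y ->
  vertex_subgroup s y.
Proof.
move=> sx Nx xy; have [[|[h a] w] [_ xw]] := commute_fixes_path sx xy.
  by rewrite /= invg1 mul1g.
case: Nx; exists h, (edge_minus a); first by exists a; left.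
case: xw => hE _; apply/conj_setE; rewrite conjgE -{1}hE.
exact: coset_rep_carry.
Qed.

Lemma conj_commute_in_vertex g s x y :
  conj_set g (vertex_subgroup s) x -> ~ in_conj_edge_subgroup x -> commute x y ->
  conj_set g (vertex_subgroup s) y.
Proof.
move=> /conj_setE sx Nx xy; apply/conj_setE.
apply: (commute_in_vertex sx); last by rewrite /commute -!conjMg xy.
case=> k [H He /conj_setE]; rewrite -conjgM => /conj_setE Hx.
by apply: Nx; exists (g * k), H.
Qed.

(** * Commuting pairs without fixed vertex *)

(** The element [g] is chosen so that the edge given by [commuting_axis] is the
    translate by [g] of the one whose stabilizer is the edge group of [a]. *)
Lemma commute_no_fixed_vertex x y :
  commute x y -> ~ in_conj_vertex_subgroup x ->
  exists (g W : pi1 D) (j k : int) (a : edge D),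
    [/\ edge_minus a ((x * (expgz W j)^-1) ^ g),
        edge_minus a ((y * (expgz W k)^-1) ^ g), commute W x & commute W y].
Proof.
move=> xy Nx; have [[[[s0 _] _] _] _] := mtree_maximal D.
pose P w := exists s, nf s0 w s.
have P_rcons w l : P (rcons w l) -> P w.
  by case: l => h a [s /nf_rcons [nw _ _]]; exists (org a).
have P_act g w : P w -> P (act s0 g w).
  by case=> s nw; exists s; exact: nf_act.
have act1P w : P w -> act s0 1 w = w by case=> s; exact: act1.
have actMP g h w : P w -> act s0 (g * h) w = act s0 g (act s0 h w).
  by case=> s; exact: actM.
have rv_neq a : edge_rev a <> a by apply/eqP; exact: edge_rev_neq.
have P0 : P [::] by exists s0.
have nofix w : P w -> act s0 x w <> w.
  case=> s nw xw; apply: Nx; exists (nf_label w), s.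
  by apply/conj_setE; exact: act_stab nw xw.
have [W [j [k [w [[h a] [Wx Wy [s nw] fixed]]]]]] :=
  commuting_axis rv_neq (@edge_revK D) P_rcons P_act act1P actMP
    (@preserves_adj_act s0) P0 xy nofix.
have [nw' ah sE] := nf_rcons nw.
have edgeP g : act s0 g w = w /\ act s0 g (rcons w (h, a)) = rcons w (h, a) ->
    edge_minus a (g ^ (nf_label w * h)).
  case=> gw gwl; apply: edge_stab.
    rewrite conjgM; have := act_stab nw' gw; set c := g ^ _ => ac.
    rewrite conjgE; apply: vertex_subgroupM; first exact: vertex_subgroupV.
    exact: vertex_subgroupM.
  by rewrite -conjgM -sE; have := act_stab nw gwl; rewrite nf_label_rcons.
by exists (nf_label w * h), W, j, k, a; split=> //; apply/edgeP/fixed; [left|right].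
Qed.

End TreeAction.

Theorem mainTheorem2 (D : decomposed_graph_of_groups) (x y : pi1 D)
    (x_y_commute : commute x y) :
  (in_edge_subgroup x -> circuit_labels x y) /\
  (forall (g : pi1 D) (s : vertex D),
     conj_set g (vertex_subgroup s) x -> ~ in_conj_edge_subgroup x ->
     conj_set g (vertex_subgroup s) y) /\
  (~ in_conj_vertex_subgroup x -> ~ in_conj_vertex_subgroup y ->
     exists (g W : pi1 D) (j k : int) (a : edge D) (h h' : pi1 D),
       edge_minus a h /\ edge_minus a h' /\
       x = g * h * g^-1 * expgz W j /\
       y = g * h' * g^-1 * expgz W k /\
       commute (g * h * g^-1) (g * h' * g^-1) /\
       commute (g * h * g^-1) W /\
       commute (g * h' * g^-1) W) /\
  ((in_conj_edge_subgroup x \/ in_conj_edge_subgroup y) \/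
   (in_conj_vertex_subgroup x /\ ~ in_conj_edge_subgroup x) \/
   (~ in_conj_vertex_subgroup x /\ ~ in_conj_vertex_subgroup y)).
Proof.
have yx := commute_sym x_y_commute.
split; [|split; [|split]].
- case=> H [a HE] Hx.
  have [b bx] : exists b, edge_minus b x.
    by move: Hx; case: HE => ->; [exists a | exists (edge_rev a)].
  exact: commute_circuit (edge_minus_vertex bx) x_y_commute.
- by move=> g s xs Nx; exact: conj_commute_in_vertex xs Nx x_y_commute.
- move=> Nx _.
  have [g [W [j [k [a [ah ah' Wx Wy]]]]]] := commute_no_fixed_vertex x_y_commute Nx.
  exists g, W, j, k, a, ((x * (expgz W j)^-1) ^ g), ((y * (expgz W k)^-1) ^ g); split; first exact: ah.
  split; first exact: ah'.
  rewrite !conjg_cancel !mulgVK.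
  have xWV n : commute x (expgz W n)^-1.
    by apply/commuteV/commute_expgz/commute_sym.
  have yWV n : commute y (expgz W n)^-1.
    by apply/commuteV/commute_expgz/commute_sym.
  have WWV n : commute W (expgz W n)^-1 by exact/commuteV/commute_expgz.
  have xW : commute (x * (expgz W j)^-1) W.
    by apply/commute_sym/commuteM => //; exact: WWV.
  split=> //; split=> //; split; last first.
    by split=> //; apply/commute_sym/commuteM => //; exact: WWV.
  apply: commuteM; last by apply/commuteV/commute_expgz.
  by apply/commute_sym/commuteM => //; exact: yWV.
- have [|Nex] := EM (in_conj_edge_subgroup x); first by left; left.
  have [|Ney] := EM (in_conj_edge_subgroup y); first by left; right.
  right; have [vx|Nvx] := EM (in_conj_vertex_subgroup x); first by left.
  right; split=> // -[g [s ys]]; apply: Nvx; exists g, s.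
  exact: conj_commute_in_vertex ys Ney yx.
Qed.
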